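(* Suppose the trajectory set $\mathcal{S}$ satisfies the following two assumptions: (a) If $(S,j)$ is a good up-down node, then for every $\epsilon>0$ there are $S^{\epsilon,1},S^{\epsilon,2}\in\mathcal{S}_{(S,j)}$ such that $(S^{\epsilon,1},j+1)$ and $(S^{\epsilon,2},j+1)$ are good nodes satisfying $$S^{\epsilon,1}_{j+1}-S_j\ge-\epsilon,\qquad S^{\epsilon,2}_{j+1}-S_j\le\epsilon.$$ (b) If $(S^n)_{n\ge0}$ is a sequence in $\mathcal{S}$ satisfying $S^n_i=S^{n+1}_i$ for all $n\ge 0$ and $0\le i\le n$, and if there is an $n_0\ge0$ such that $(S^n,n)$ is a good node for every $n\ge n_0$, then $(S^n_n)_{n\ge0}\in\mathcal{S}$. Then, for every node $(S,j)$, property $(L_{(S,j)})$ holds if and only if $(S,j)$ is a good node.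
   Context: Trajectories and nodes. Fix $s_0\in\mathbb{R}$ and a trajectory set $\mathcal{S}$, i.e. a set of real sequences $S=(S_i)_{i\ge 0}$ with $S_0=s_0$. For $S\in\mathcal{S}$ and $j\ge 0$ let $\mathcal{S}_{(S,j)}=\{\tilde S\in\mathcal{S}:\tilde S_i=S_i,\ 0\le i\le j\}$; the pair $(S,j)$ (identified with $\mathcal{S}_{(S,j)}$) is called a node. Write $\Delta_iS=S_{i+1}-S_i$. A node $(S,j)$ is up-down if $\sup_{\tilde S\in\mathcal{S}_{(S,j)}}(\tilde S_{j+1}-S_j)>0$ and $\inf_{\tilde S\in\mathcal{S}_{(S,j)}}(\tilde S_{j+1}-S_j)<0$; it is flat if both this supremum and this infimum equal $0$; otherwise it is an arbitrage node. Good nodes. Let $N(S,j)=\{\tilde S\in\mathcal{S}_{(S,j)}:\text{ for some }k\ge j,\ (\tilde S,k)\text{ is an arbitrage node and }\tilde S_{k+1}\ne\tilde S_k\}$. The node $(S,j)$ is good if $\mathcal{S}_{(S,j)}\ne N(S,j)$, and bad otherwise. Portfolios. $\mathcal{H}_{(S,j)}$ is the set of sequences $H=(H_i)_{i\ge j}$ of functions $H_i:\mathcal{S}_{(S,j)}\to\mathbb{R}$ such that $H_i(\tilde S)=H_i(\hat S)$ whenever $\tilde S_k=\hat S_k$ for $j\le k\le i$ (no measurability is required). For $V\in\mathbb{R}$, $H\in\mathcal{H}_{(S,j)}$, $n\ge j$, put $\Pi_{j,n}^{V,H}(\tilde S)=V+\sum_{i=j}^{n-1}H_i(\tilde S)\Delta_i\tilde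 S$ for $\tilde S\in\mathcal{S}_{(S,j)}$. $\mathcal{E}_{(S,j)}$ is the vector space of all functions $\Pi_{j,n}^{V,H}$ on $\mathcal{S}_{(S,j)}$ ($V\in\mathbb{R}$, $H\in\mathcal{H}_{(S,j)}$, $n$ an integer $\ge j$), and $\mathcal{E}_{(S,j)}^+$ is the set of its nonnegative elements. Property $(L_{(S,j)})$: whenever $f=\Pi_{j,n_f}^{V,H}\in\mathcal{E}_{(S,j)}$ and $f_m=\liminf_{n\to\infty}\Pi_{j,n}^{V^m,H^m}$ with $\Pi_{j,n}^{V^m,H^m}\in\mathcal{E}^+_{(S,j)}$ for all $n\ge j$, $m\ge1$, satisfy $f\le\sum_{m\ge1}f_m$ on $\mathcal{S}_{(S,j)}$, then $V\le\sum_{m\ge1}V^m$. *)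

(* Defs.v *)
From HB Require Import structures.
From mathcomp Require Import all_boot all_order all_algebra.
From mathcomp Require Import all_classical all_reals all_analysis.

Set Implicit Arguments.
Unset Strict Implicit.
Unset Printing Implicit Defensive.

Import Order.TTheory GRing.Theory Num.Theory.
Import numFieldNormedType.Exports.

Local Open Scope classical_set_scope.
Local Open Scope ring_scope.

Section Trajectories.
Context {R : realType}.
Implicit Types (calS : set (nat -> R)) (S T : nat -> R) (H : nat -> (nat -> R) -> R).

Definition trajectory_set (s0 : R) calS : Prop :=
  forall S, calS S -> S 0%N = s0.

Definition node calS S (j : nat) : set (nat -> R) :=
  [set T | calS T /\ forall i, (i <= j)%N -> T i = S i].

Definition Delta (i : nat) S : R := S i.+1 - S i.

(* The increments out of a node need not be bounded, so the supremum and the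
   infimum are taken in the extended reals. *)
Definition sup_increment calS S (j : nat) : \bar R :=
  ereal_sup [set (T j.+1 - S j)%:E | T in node calS S j].

Definition inf_increment calS S (j : nat) : \bar R :=
  ereal_inf [set (T j.+1 - S j)%:E | T in node calS S j].

Definition up_down calS S (j : nat) : Prop :=
  (0 < sup_increment calS S j)%E /\ (inf_increment calS S j < 0)%E.

Definition flat calS S (j : nat) : Prop :=
  sup_increment calS S j = 0%E /\ inf_increment calS S j = 0%E.

Definition arbitrage_node calS S (j : nat) : Prop :=
  ~ up_down calS S j /\ ~ flat calS S j.

Definition N_set calS S (j : nat) : set (nat -> R) :=
  [set T | node calS S j T /\
    exists k, [/\ (j <= k)%N, arbitrage_node calS T k & T k.+1 <> T k]].

Definition good calS S (j : nat) : Prop := node calS S j <> N_set calS S j.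

(* A sequence (H_i)_{i >= j} of functions on the node is encoded by total
   functions; the values at i < j or outside the node are never used. *)
Definition portfolio calS S (j : nat) H : Prop :=
  forall i, (j <= i)%N -> forall T U, node calS S j T -> node calS S j U ->
    (forall k, (j <= k <= i)%N -> T k = U k) -> H i T = H i U.

Definition Pi (j n : nat) (V : R) H (T : nat -> R) : R :=
  V + \sum_(j <= i < n) H i T * Delta i T.

(* Functions on the node are represented by total functions up to equality on
   the node. *)
Definition elementary calS S (j : nat) : set ((nat -> R) -> R) :=
  [set f | exists V H n, [/\ portfolio calS S j H, (j <= n)%N &
    forall T, node calS S j T -> f T = Pi j n V H T]].

Definition elementary_nneg calS S (j : nat) : set ((nat -> R) -> R) :=
  [set f | elementary calS S j f /\ forall T, node calS S j T -> 0 <= f T].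

(* The limits inferior and the series over m >= 1 are taken in the extended
   reals.  All terms of both series are nonnegative (V m = Pi j j (V m) (H m)),
   so they always have a sum in [0, +oo]. *)
Definition property_L calS S (j : nat) : Prop :=
  forall (Vf : R) (Hf : nat -> (nat -> R) -> R) (nf : nat)
         (V : nat -> R) (H : nat -> nat -> (nat -> R) -> R),
    portfolio calS S j Hf -> (j <= nf)%N ->
    (forall m, (1 <= m)%N -> portfolio calS S j (H m)) ->
    (forall m n, (1 <= m)%N -> (j <= n)%N ->
      elementary_nneg calS S j (Pi j n (V m) (H m))) ->
    (forall T, node calS S j T ->
      ((Pi j nf Vf Hf T)%:E <=
        \sum_(1 <= m <oo) limn_einf (fun n => (Pi j n (V m) (H m) T)%:E))%E) ->
    (Vf%:E <= \sum_(1 <= m <oo) (V m)%:E)%E.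

End Trajectories.

(* Main.v *)
Require Import Defs.
From HB Require Import structures.
From mathcomp Require Import all_boot all_order all_algebra.
From mathcomp Require Import all_classical all_reals all_analysis.
From mathcomp Require Import lra.

(** Both directions compare a portfolio with what it earns along a trajectory.

    Bad node: every trajectory makes a nonzero move at an arbitrage node, now or
    later.  The nonzero moves of an arbitrage node all have the same sign, so
    holding one unit with that sign there, and nothing elsewhere, is a strategy of zero initial
    capital whose wealth is nonnegative and eventually bounded below by a
    positive number on each trajectory ([arbitrage_gain]).  Countably many
    copies of it superhedge the constant 1 for free, which contradicts (L).

    Good node: suppose that the portfolios superhedge [f] with total capital
    smaller than that of [f].  A trajectory is built step by step through good
    nodes, along which the aggregate wealth of the portfolios stays below the
    wealth of [f] by a fixed amount.
    At an up-down node the nonnegativity of each portfolio after an up move and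
    after a down move bounds its position by a multiple of its present wealth,
    so the aggregate position of all portfolios is a convergent series
    ([aggregate_position]); assumption (a) gives a move to a good node on which
    this aggregate position, net of the position of [f], gains arbitrarily
    little ([good_cheap_succ]).  At any other good node there is a move of size
    zero to a good node ([good_stationary_succ]).  Assumption (b) makes the
    limit a trajectory of the set ([aggregate_wealth_path]), and Fatou's lemma
    for series ([sum_liminf_le]) contradicts the superhedging there. *)

Set Implicit Arguments.
Unset Strict Implicit.
Unset Printing Implicit Defensive.

Import Order.TTheory GRing.Theory Num.Theory.
Import numFieldNormedType.Exports.

Local Open Scope classical_set_scope.
Local Open Scope ring_scope.

(** * Nodes *)

Lemma node_refl (R : realType) (calS : set (nat -> R)) S j :
  calS S -> node calS S j S.
Proof. by []. Qed.

Lemma node_trans (R : realType) (calS : set (nat -> R)) S j T k U :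
  (j <= k)%N -> node calS S j T -> node calS T k U -> node calS S j U.
Proof.
move=> jk [_ TS] [cU UT]; split=> // i ij.
by rewrite UT ?(leq_trans ij)// TS.
Qed.

Lemma eq_node (R : realType) (calS : set (nat -> R)) T U k :
  (forall i, (i <= k)%N -> T i = U i) -> node calS T k = node calS U k.
Proof.
move=> TU; apply/seteqP; split=> W [cW WT]; split=> // i ik.
  by rewrite -TU// WT.
by rewrite TU// WT.
Qed.

Lemma eq_arbitrage_node (R : realType) (calS : set (nat -> R)) T U k :
  (forall i, (i <= k)%N -> T i = U i) ->
  arbitrage_node calS T k = arbitrage_node calS U k.
Proof.
move=> TU; rewrite /arbitrage_node /up_down /flat /sup_increment /inf_increment.
by rewrite (eq_node _ TU) TU.
Qed.

Lemma goodP (R : realType) (calS : set (nat -> R)) S j :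
  good calS S j <-> exists2 T, node calS S j T &
    forall k, (j <= k)%N -> arbitrage_node calS T k -> T k.+1 = T k.
Proof.
split=> [gS|[T nT stay] eN].
  apply: contrapT => noT; apply: gS; apply/seteqP; split=> [T nT|T []//].
  split=> //; apply: contrapT => noK; apply: noT; exists T => // k jk aT.
  by apply: contrapT => neq; apply: noK; exists k.
by move: nT; rewrite eN => -[_ [k [jk /(stay _ jk)]]].
Qed.

(** A trajectory witnessing goodness does not move at the node itself, whether
    the node is flat or of arbitrage type, and it still witnesses goodness one
    step later. *)
Lemma good_stationary_succ (R : realType) (calS : set (nat -> R)) T n :
  good calS T n -> ~ up_down calS T n ->
  exists U, [/\ node calS T n U, good calS U n.+1 & Delta n U = 0].
Proof.
move=> /goodP[U nU stay] nud; exists U; split=> //.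
  apply/goodP; exists U; first by apply: node_refl; case: nU.
  by move=> k nk; apply: stay; exact: ltnW.
have [_ UT] := nU.
have [[s0 i0]|nflat] := pselect (flat calS T n).
  have mU : [set (W n.+1 - T n)%:E | W in node calS T n] (U n.+1 - T n)%:E.
    by exists U.
  have := ereal_sup_ubound mU; have := ereal_inf_lbound mU.
  rewrite -/(sup_increment calS T n) -/(inf_increment calS T n) s0 i0 !lee_fin.
  by move=> ge0 le0; apply/eqP; rewrite /Delta (UT n)// eq_le ge0 le0.
by rewrite /Delta stay ?subrr// (@eq_arbitrage_node _ _ _ T)//.
Qed.

Lemma up_down_moves (R : realType) (calS : set (nat -> R)) T n :
  up_down calS T n ->
  (exists2 U, node calS T n U & 0 < Delta n U) /\
  (exists2 U, node calS T n U & Delta n U < 0).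
Proof.
move=> [/ereal_sup_gt[_ [U nU <-]] + /ereal_inf_lt[_ [W nW <-]]].
rewrite !lte_fin => U0 W0; split; [exists U => //|exists W => //].
  by case: nU => _ UT; rewrite /Delta (UT n).
by case: nW => _ WT; rewrite /Delta (WT n).
Qed.

(** * Portfolios *)

Lemma Pi_nil (R : realType) j V H (T : nat -> R) : Pi j j V H T = V.
Proof. by rewrite /Pi big_geq// addr0. Qed.

Lemma Pi_recr (R : realType) j n V H (T : nat -> R) : (j <= n)%N ->
  Pi j n.+1 V H T = Pi j n V H T + H n T * Delta n T.
Proof. by move=> jn; rewrite /Pi big_nat_recr//= addrA. Qed.

Lemma portfolio_node (R : realType) (calS : set (nat -> R)) S j H T n i U :
  portfolio calS S j H -> node calS S j T -> (j <= i <= n)%N ->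
  node calS T n U -> H i U = H i T.
Proof.
move=> pH nT /andP[ji i_n] nU; apply: pH => //.
  exact: node_trans (leq_trans ji i_n) nT nU.
by move=> k /andP[_ ki]; case: nU => _; apply; exact: leq_trans i_n.
Qed.

(** Wealth at time [n] is known at the node reached at time [n], so that the
    choice of the next node affects only the next increment. *)
Lemma Pi_node (R : realType) (calS : set (nat -> R)) S j V H T n U :
  portfolio calS S j H -> node calS S j T -> node calS T n U ->
  Pi j n V H U = Pi j n V H T.
Proof.
move=> pH nT nU; congr (_ + _); rewrite [LHS]big_nat [RHS]big_nat.
apply: eq_bigr => i /andP[ji i_n].
rewrite (portfolio_node pH nT _ nU) ?ji ?(ltnW i_n)//.
by case: nU => _ UT; rewrite /Delta !UT// ltnW.
Qed.

(** Stopping turns the wealth of [f], fixed from time [nf] on, into a portfolio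
    wealth at all times, which can be compared with the other portfolios step by
    step. *)
Definition stop_at (R : realType) (nf : nat) (H : nat -> (nat -> R) -> R) :=
  fun i T => if (i < nf)%N then H i T else 0.

Lemma portfolio_stop_at (R : realType) (calS : set (nat -> R)) S j nf H :
  portfolio calS S j H -> portfolio calS S j (stop_at nf H).
Proof.
move=> pH i ji T U nT nU TU; rewrite /stop_at; case: ifP => // _.
exact: pH.
Qed.

Lemma Pi_stop_at (R : realType) j nf n V H (T : nat -> R) :
  (j <= nf <= n)%N -> Pi j n V (stop_at nf H) T = Pi j nf V H T.
Proof.
move=> /andP[jnf nfn]; rewrite /Pi (big_cat_nat jnf nfn)/=.
rewrite [X in _ + (_ + X)]big1_seq ?addr0; last first.
  move=> i; rewrite mem_index_iota => /andP[_ /andP[+ _]].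
  by rewrite /stop_at leqNgt => /negbTE ->; rewrite mul0r.
congr (_ + _); rewrite [LHS]big_nat [RHS]big_nat.
by apply: eq_bigr => i /andP[_ inf]; rewrite /stop_at inf.
Qed.

(** * Bad nodes *)

(** The direction of the position is read off the infimum: at an arbitrage node
    all the moves are nonnegative or all are nonpositive. *)
Definition arbitrage_strategy (R : realType) (calS : set (nat -> R))
    (i : nat) (T : nat -> R) : R :=
  if `[< arbitrage_node calS T i >] then
    if (0 <= inf_increment calS T i)%E then 1 else -1
  else 0.

Lemma arbitrage_gain (R : realType) (calS : set (nat -> R)) T i : calS T ->
  arbitrage_strategy calS i T * Delta i T =
  if `[< arbitrage_node calS T i >] then `|Delta i T| else 0.
Proof.
move=> cT; rewrite /arbitrage_strategy; case: asboolP; last by rewrite mul0r.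
move=> [nud _].
have mT : [set (W i.+1 - T i)%:E | W in node calS T i] (Delta i T)%:E.
  by exists T.
case: ifPn => [inf0|]; rewrite ?mul1r.
  have := le_trans inf0 (ereal_inf_lbound mT).
  by rewrite lee_fin => ?; rewrite ger0_norm.
rewrite -ltNge mulN1r => inf0.
have /negP : ~ (0 < sup_increment calS T i)%E by move=> sup0; apply: nud.
rewrite -leNgt => /(le_trans (ereal_sup_ubound mT)).
by rewrite lee_fin => ?; rewrite ler0_norm.
Qed.

Lemma portfolio_arbitrage (R : realType) (calS : set (nat -> R)) S j :
  portfolio calS S j (arbitrage_strategy calS).
Proof.
move=> i ji T U [_ TS] [_ US] TU.
have eTU k : (k <= i)%N -> T k = U k.
  move=> ki; have [jk|kj] := leqP j k; first by apply: TU; rewrite jk ki.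
  by rewrite TS ?US// ltnW.
rewrite /arbitrage_strategy (eq_arbitrage_node _ eTU).
by rewrite /inf_increment (eq_node _ eTU) eTU.
Qed.

Lemma property_L_good (R : realType) (calS : set (nat -> R)) S j :
  property_L calS S j -> good calS S j.
Proof.
move=> L bad.
pose H := arbitrage_strategy calS.
have gain0 T i : calS T -> 0 <= H i T * Delta i T.
  by move=> cT; rewrite /H arbitrage_gain//; case: ifP.
have Pi0 T n : calS T -> 0 <= Pi j n 0 H T.
  by move=> cT; rewrite /Pi add0r sumr_ge0// => i _; exact: gain0.
suff: (1%:E <= \sum_(1 <= m <oo) (0:R)%:E)%E.
  by rewrite eseries0// lee_fin ler10.
apply: (L 1 (fun _ _ => 0) j (fun=> 0) (fun=> H)) => //.
- by move=> _ _; exact: portfolio_arbitrage.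
- move=> _ n _ jn; split; last by move=> T [cT _]; exact: Pi0.
  by exists 0, H, n; split=> //; exact: portfolio_arbitrage.
move=> T nT; rewrite Pi_nil; have [cT _] := nT.
move: (nT); rewrite bad => -[_ [k [jk aT mv]]].
set c := `|Delta k T|.
have c0 : 0 < c by rewrite normr_gt0 subr_eq0; apply/eqP.
have Pic n : (k < n)%N -> c <= Pi j n 0 H T.
  elim: n => // n IHn kn; rewrite Pi_recr//; last exact: leq_trans jk kn.
  move: kn; rewrite ltnS leq_eqVlt => /predU1P[<-|/IHn cn].
    rewrite [H k T * _]arbitrage_gain//; case: asboolP => // _.
    by rewrite lerDr Pi0.
  by rewrite (le_trans cn)// lerDl gain0.
set l := limn_einf _.
have cl : (c%:E <= l)%E.
  rewrite /l limn_einf_lim; apply: lime_ge; first exact: is_cvg_einfs.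
  exists k.+1 => // n /= kn; apply: le_ereal_inf_tmp => _ [i /= ni <-].
  by rewrite lee_fin Pic// (leq_trans kn).
(* Enough copies of a liminf that is at least [c] add up to 1. *)
pose N := Num.bound (c^-1).
have l0 : (0 <= l)%E by rewrite (le_trans _ cl)// lee_fin ltW.
apply: le_trans (nneseries_lim_ge N.+1 _) => //.
apply: (@le_trans _ _ (\sum_(1 <= m < N.+1) c%:E)%E); last exact: lee_sum.
rewrite sumEFin sumr_const_nat subn1 lee_fin -mulr_natl.
rewrite -ler_pdivrMr// div1r ltW//.
by apply: archi_boundP; rewrite invr_ge0 ltW.
Qed.

(** * Aggregating countably many portfolios *)

(** Nonnegativity for one positive and one negative move forces
    [`|h m| <= (x^-1 - y^-1) * a m], so that [h] is summable because [a] is; the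
    aggregate position is its sum. *)
Lemma aggregate_position (R : realType) (a h : nat -> R) (x y B : R) :
  0 < x -> y < 0 -> (forall m, 0 <= a m) ->
  (forall m, 0 <= a m + h m * x) -> (forall m, 0 <= a m + h m * y) ->
  (forall N, \sum_(0 <= m < N) a m <= B) ->
  exists G, forall d, (forall m, 0 <= a m + h m * d) ->
    forall N, \sum_(0 <= m < N) (a m + h m * d) <= B + G * d.
Proof.
move=> x0 y0 a0 ax ay aB.
have nd (u : nat -> R) : (forall m, 0 <= u m) ->
    {homo series u : n m / (n <= m)%N >-> n <= m}.
  move=> u0; apply/nondecreasing_seqP => n.
  by rewrite /series/= big_nat_recr//= lerDl.
have ca : cvgn (series a).
  apply: nondecreasing_is_cvgn; first exact: nd.
  by exists B => _ [N _ <-]; exact: aB.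
pose C := x^-1 - y^-1.
have C0 : 0 <= C by rewrite subr_ge0 ltW// (lt_trans _ (_ : 0 < x^-1))
  ?invr_lt0 ?invr_gt0.
have hC m : `|h m| <= C * a m.
  have xV : 0 <= x^-1 * a m by rewrite mulr_ge0// invr_ge0 ltW.
  have yV : 0 <= - y^-1 * a m by rewrite mulr_ge0// oppr_ge0 invr_le0 ltW.
  have hx : - (x^-1 * a m) <= h m.
    by rewrite -mulrN mulrC ler_pdivrMr// -subr_ge0 opprK addrC.
  have hy : h m <= - y^-1 * a m.
    by rewrite mulNr -mulrN mulrC ler_ndivlMr// -subr_ge0 opprK addrC.
  by rewrite ler_norml /C mulrBl; apply/andP; split; lra.
have ch : cvgn (series h).
  apply: normed_cvg; apply: (series_le_cvg (v_ := fun m => C * a m)) => //.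
  - by move=> m /=.
  - by move=> m; exact: mulr_ge0.
  - exact: is_cvg_seriesZ.
exists (limn (series h)) => d ad N.
have eqs : series (fun m => a m + h m * d) =
    series a + (fun n => series h n * d).
  by apply/funext => n; rewrite /series/= big_split/= -mulr_suml.
have cvg_ad : series (fun m => a m + h m * d) @ \oo -->
    limn (series a) + limn (series h) * d.
  rewrite eqs; apply: cvgD => //; apply: cvgM => //; exact: cvg_cst.
apply: (@le_trans _ _ (limn (series (fun m => a m + h m * d)))).
  apply: nondecreasing_cvgn_le; first exact: nd.
  by apply/cvg_ex; eexists; exact: cvg_ad.
rewrite (cvg_lim _ cvg_ad)// lerD2r; apply: limr_le => //.
by near=> n; exact: aB.
Unshelve. all: by end_near. Qed.

(** Fatou's lemma for series, with the bound only required of partial sums. *)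
Lemma sum_liminf_le (R : realType) (u : nat -> nat -> R) (c : R) (n0 N : nat) :
  (forall m n, 0 <= u m n) ->
  (forall n, (n0 <= n)%N -> \sum_(0 <= m < N) u m n <= c) ->
  (\sum_(0 <= m < N) limn_einf (fun n => (u m n)%:E) <= c%:E)%E.
Proof.
move=> u0 uc.
pose v m := einfs (fun n => (u m n)%:E).
have cv : (\sum_(0 <= m < N) v m n)%E @[n --> \oo] -->
    (\sum_(0 <= m < N) limn_einf (fun n => (u m n)%:E))%E.
  apply: cvg_nnesum => m _.
    apply: nearW => n; apply: le_ereal_inf_tmp => _ [i _ <-].
    by rewrite lee_fin.
  by rewrite limn_einf_lim; exact: is_cvg_einfs.
rewrite -(cvg_lim _ cv)//; apply: lime_le.
  by apply/cvg_ex; eexists; exact: cv.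
exists n0 => // n /= n0n.
apply: (@le_trans _ _ (\sum_(0 <= m < N) (u m n)%:E)%E).
  by apply: lee_sum => m _; apply: ereal_inf_lbound; exists n => /=.
by rewrite sumEFin lee_fin uc.
Qed.

(** * Good nodes *)

Definition small_good_moves (R : realType) (calS : set (nat -> R)) : Prop :=
  forall (S : nat -> R) (j : nat), calS S ->
  good calS S j -> up_down calS S j ->
  forall eps : R, 0 < eps ->
  exists S1 S2 : nat -> R,
    [/\ node calS S j S1, node calS S j S2,
        good calS S1 j.+1, good calS S2 j.+1 &
        S1 j.+1 - S j >= - eps /\ S2 j.+1 - S j <= eps].

Definition good_limits (R : realType) (calS : set (nat -> R)) : Prop :=
  forall Sn : nat -> nat -> R,
  (forall n, calS (Sn n)) ->
  (forall n i, (i <= n)%N -> Sn n i = Sn n.+1 i) ->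
  (exists n0 : nat, forall n, (n0 <= n)%N -> good calS (Sn n) n) ->
  calS (fun n => Sn n n).

Lemma trajectory_chain (R : realType) (P : nat -> (nat -> R) -> Prop) j S :
  P j S ->
  (forall n T, (j <= n)%N -> P n T ->
    exists2 U, (forall i, (i <= n)%N -> U i = T i) & P n.+1 U) ->
  exists Sn : nat -> nat -> R,
    [/\ forall n, (n <= j)%N -> Sn n = S,
        forall n i, (i <= n)%N -> Sn n i = Sn n.+1 i &
        forall n, (j <= n)%N -> P n (Sn n)].
Proof.
move=> PS next.
have /choice[g gP] : forall nT : nat * (nat -> R), exists U,
    (j <= nT.1)%N -> P nT.1 nT.2 ->
    (forall i, (i <= nT.1)%N -> U i = nT.2 i) /\ P nT.1.+1 U.
  move=> [n T]; have [jnP|njP] := pselect ((j <= n)%N /\ P n T).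
    by have [U UT PU] := next n T jnP.1 jnP.2; exists U.
  by exists T => /= jn PT; exfalso; apply: njP.
pose fix Sn n := if n is n'.+1 then
  if (j <= n')%N then g (n', Sn n') else S else S.
have Sj n : (n <= j)%N -> Sn n = S.
  by case: n => //= n nj; rewrite leqNgt nj.
have PSn n : (j <= n)%N -> P n (Sn n).
  elim: n => [|n IHn]; first by rewrite leqn0 => /eqP j0; rewrite j0 in PS.
  rewrite leq_eqVlt => /predU1P[<-|jn]; first by rewrite Sj.
  move: jn; rewrite ltnS => jn.
  by rewrite /= jn; apply: (gP (n, Sn n) jn (IHn jn)).2.
exists Sn; split=> // n i i_n.
have [jn|nj] := leqP j n; last by rewrite !Sj// ltnW.
by rewrite /= jn (gP (n, Sn n) jn (PSn n jn)).1.
Qed.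

Section GoodNodes.
Context {R : realType} (calS : set (nat -> R)) (S : nat -> R) (j : nat)
  (V : nat -> R) (H : nat -> nat -> (nat -> R) -> R)
  (Vf : R) (Hf : nat -> (nat -> R) -> R)
  (pH : forall m, portfolio calS S j (H m))
  (pHf : portfolio calS S j Hf)
  (Pi_ge0 : forall m n T, (j <= n)%N -> node calS S j T ->
    0 <= Pi j n (V m) (H m) T)
  (small_move : small_good_moves calS).

(** Here [G] is the aggregate position of all portfolios minus that of [f].
    The side of the small move is chosen opposite to the sign of the position
    [G]. *)
Lemma good_cheap_succ T n G e : calS T -> good calS T n -> up_down calS T n ->
  0 < e ->
  exists U, [/\ node calS T n U, good calS U n.+1 & G * Delta n U <= e].
Proof.
move=> cT gT udT e0.
have [d d0 dG] : exists2 d, 0 < d & `|G| * d <= e.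
  exists (e / (`|G| + 1)); first by rewrite divr_gt0// ltr_pwDr.
  by rewrite mulrCA ler_piMr ?(ltW e0)// ler_pdivrMr ?mul1r ?lerDl// ltr_pwDr.
have [U1 [U2 [n1 n2 g1 g2 [mv1 mv2]]]] := small_move cT gT udT d0.
have [G0|G0] := leP 0 G.
  exists U2; split=> //; apply: le_trans dG; rewrite ger0_norm// /Delta.
  by have [_ /(_ n (leqnn n)) ->] := n2; rewrite ler_wpM2l.
exists U1; split=> //; apply: le_trans dG; rewrite ltr0_norm// /Delta.
by have [_ /(_ n (leqnn n)) ->] := n1; rewrite mulNr -mulrN ler_wnM2l// ltW.
Qed.

Lemma aggregate_wealth_succ T n c e :
  (j <= n)%N -> node calS S j T -> good calS T n -> 0 < e ->
  (forall N, \sum_(0 <= m < N) Pi j n (V m) (H m) T <= Pi j n Vf Hf T - c) ->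
  exists U, [/\ node calS T n U, good calS U n.+1 &
    forall N, \sum_(0 <= m < N) Pi j n.+1 (V m) (H m) U <=
      Pi j n.+1 Vf Hf U - c + e].
Proof.
move=> jn nT gT e0 WT; have [cT _] := nT.
have PiE V0 H0 U : portfolio calS S j H0 -> node calS T n U ->
    Pi j n.+1 V0 H0 U = Pi j n V0 H0 T + H0 n T * Delta n U.
  move=> pH0 nU; rewrite Pi_recr// (Pi_node _ pH0 nT nU).
  by rewrite (portfolio_node pH0 nT _ nU)// jn leqnn.
have [udT|nud] := pselect (up_down calS T n); last first.
  have [U [nU gU dU]] := good_stationary_succ gT nud.
  exists U; split=> // N; rewrite PiE// dU mulr0 addr0.
  under eq_bigr do rewrite PiE// dU mulr0 addr0.
  by rewrite (le_trans (WT N))// lerDl ltW.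
have Pi_succ0 m U : node calS T n U ->
    0 <= Pi j n (V m) (H m) T + H m n T * Delta n U.
  move=> nU; rewrite -PiE//; apply: Pi_ge0; first exact: leqW.
  exact: node_trans nT nU.
have [[X nX X0] [Y nY Y0]] := up_down_moves udT.
have [G GP] := aggregate_position X0 Y0 (fun m => Pi_ge0 m jn nT)
  (fun m => Pi_succ0 m X nX) (fun m => Pi_succ0 m Y nY) WT.
have [U [nU gU dU]] := good_cheap_succ (G - Hf n T) cT gT udT e0.
exists U; split=> // N; rewrite PiE//.
under eq_bigr do rewrite PiE//.
apply: (le_trans (GP _ (fun m => Pi_succ0 m U nU) N)).
by move: dU; rewrite mulrBl; lra.
Qed.

(** The deficit is [d + d / 2 ^ n] at time [n], so that time [n] may lose
    [d / 2 ^ n.+1] and the deficit never falls below [d]. *)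
Lemma aggregate_wealth_path d :
  0 < d -> calS S -> good calS S j ->
  (forall N, \sum_(0 <= m < N) V m <= Vf - (d + d)) ->
  good_limits calS ->
  exists2 T, node calS S j T & forall n N, (j <= n)%N ->
    \sum_(0 <= m < N) Pi j n (V m) (H m) T <= Pi j n Vf Hf T - d.
Proof.
move=> d0 cS gS VB closed.
pose e n : R := d / 2 ^+ n.
have e0 n : 0 < e n by rewrite divr_gt0// exprn_gt0.
have eS n : e n = e n.+1 + e n.+1.
  by rewrite /e exprS invfM; lra.
pose P n T := [/\ node calS S j T, good calS T n & forall N,
  \sum_(0 <= m < N) Pi j n (V m) (H m) T <= Pi j n Vf Hf T - (d + e n)].
have PS : P j S.
  split=> // N; rewrite Pi_nil.
  under eq_bigr do rewrite Pi_nil.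
  apply: (le_trans (VB N)); rewrite lerD2l lerN2 lerD2l.
  rewrite /e ler_pdivrMr ?exprn_gt0// ler_peMr ?(ltW d0)//.
  by rewrite exprn_ege1// ler1n.
have [n T jn [nT gT WT]|Sn [Sj Sn_eq PSn]] := trajectory_chain PS.
  have [U [nU gU WU]] := aggregate_wealth_succ jn nT gT (e0 n.+1) WT.
  exists U; first by case: nU.
  split=> //; first exact: node_trans nT nU.
  by move=> N; apply: (le_trans (WU N)); have := eS n; lra.
have cSn n : calS (Sn n).
  by have [jn|/ltnW nj] := leqP j n; [case: (PSn n jn) => -[]|rewrite Sj].
have cT : calS (fun n => Sn n n).
  by apply: closed => //; exists j => n /PSn[].
have Tn n i : (i <= n)%N -> Sn n i = Sn i i.
  elim: n => [|n IHn]; first by rewrite leqn0 => /eqP ->.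
  by rewrite leq_eqVlt => /predU1P[->//|i_n]; rewrite -Sn_eq ?IHn.
exists (fun n => Sn n n).
  by split=> // i ij; rewrite Sj.
move=> n N jn; have [nT gT WT] := PSn n jn.
have nlim : node calS (Sn n) n (fun n => Sn n n).
  by split=> // i i_n; rewrite Tn.
rewrite (Pi_node _ pHf nT nlim).
under eq_bigr do rewrite (Pi_node _ (pH _) nT nlim).
by apply: (le_trans (WT N)); have := e0 n; lra.
Qed.

End GoodNodes.

Lemma good_property_L (R : realType) (calS : set (nat -> R)) S j :
  small_good_moves calS ->
  good_limits calS ->
  calS S -> good calS S j -> property_L calS S j.
Proof.
move=> small_move closed cS gS Vf Hf nf V H pHf jnf pH nnegH hedge.
have sumS (f : nat -> \bar R) N :
    (\sum_(1 <= m < N.+1) f m = \sum_(0 <= m < N) f m.+1)%E.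
  by rewrite big_add1.
have Pi0 m n T : (j <= n)%N -> node calS S j T ->
    0 <= Pi j n (V m.+1) (H m.+1) T.
  by move=> jn nT; have [_ ->] := nnegH m.+1 n isT jn.
have V0 m : (1 <= m)%N -> (0 <= (V m)%:E)%E.
  by case: m => // m _; rewrite lee_fin -(Pi_nil j (V m.+1) (H m.+1) S) Pi0.
rewrite leNgt; apply/negP => sumV.
set sV := (\sum_(1 <= m <oo) (V m)%:E)%E in sumV.
have sV0 : (0 <= sV)%E by apply: nneseries_ge0 => m m1 _; exact: V0.
have sVfin : sV \is a fin_num.
  by rewrite ge0_fin_numE// (lt_trans sumV)// ltry.
pose d := (Vf - fine sV) / 2.
have d0 : 0 < d by rewrite divr_gt0// subr_gt0 -lte_fin fineK.
have VB N : \sum_(0 <= m < N) V m.+1 <= Vf - (d + d).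
  have -> : Vf - (d + d) = fine sV by rewrite /d; lra.
  rewrite -lee_fin fineK// -sumEFin -(sumS (fun m => (V m)%:E)).
  by apply: nneseries_lim_ge => m m1 _; exact: V0.
have [T nT WT] := aggregate_wealth_path (fun m => pH m.+1 isT)
  (portfolio_stop_at nf pHf) Pi0 small_move d0 cS gS VB closed.
have := hedge T nT; rewrite leNgt => /negP; apply.
apply: (@le_lt_trans _ _ (Pi j nf Vf Hf T - d)%:E); last first.
  by rewrite lte_fin ltrBlDr ltrDl.
have Pi0' m n : 0 <= Pi j n (V m.+1) (H m.+1) T.
  have [/Pi0|/ltnW nj] := leqP j n; first exact.
  by rewrite /Pi big_geq// addr0 -lee_fin V0.
apply: lime_le.
  apply: is_cvg_nneseries => -[//|m] _ _.
  rewrite limn_einf_lim; apply: lime_ge; first exact: is_cvg_einfs.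
  apply: nearW => n; apply: le_ereal_inf_tmp => _ [i _ <-].
  by rewrite lee_fin.
exists 1%N => // -[//|N] _ /=; rewrite sumS.
apply: (@sum_liminf_le _ (fun m n => Pi j n (V m.+1) (H m.+1) T) _ nf) => //.
move=> n nfn.
by rewrite -(@Pi_stop_at _ j nf n) ?jnf// WT// (leq_trans jnf).
Qed.

Theorem theoremC2 (R : realType) (s0 : R) (calS : set (nat -> R))
  (hS : trajectory_set s0 calS)
  (ha : forall (S : nat -> R) (j : nat), calS S ->
     good calS S j -> up_down calS S j ->
     forall eps : R, 0 < eps ->
     exists S1 S2 : nat -> R,
       [/\ node calS S j S1, node calS S j S2,
           good calS S1 j.+1, good calS S2 j.+1 &
           S1 j.+1 - S j >= - eps /\ S2 j.+1 - S j <= eps])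
  (hb : forall Sn : nat -> nat -> R,
     (forall n, calS (Sn n)) ->
     (forall n i, (i <= n)%N -> Sn n i = Sn n.+1 i) ->
     (exists n0 : nat, forall n, (n0 <= n)%N -> good calS (Sn n) n) ->
     calS (fun n => Sn n n)) :
  forall (S : nat -> R) (j : nat), calS S ->
    (property_L calS S j <-> good calS S j).
Proof.
move=> S j cS; split; first exact: property_L_good.
exact: good_property_L.
Qed.
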